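(* Let $G=(U,V;E)$ be a finite bipartite graph in which every vertex $r\in U\cup V$ has a strict total order $\succ_r$ on its set of neighbors $N_G(r)$. For $U'\subseteq U$, let $F(U')\subseteq V$ be the set of vertices of $V$ that are matched in a stable matching of the restricted instance on the induced subgraph $G[U'\cup V]$ (with preferences restricted accordingly). Let $\mathcal{F}=\{F(U')\mid U'\subseteq U\}$. Then $(V,\mathcal{F})$ is an antimatroid.
   Context: A matching $M\subseteq E$ is a set of edges no two of which share a vertex; for $(u,v)\in M$ write $M(u)=v$, $M(v)=u$. An edge $(u,v)$ of a graph $H$ is a blocking pair against a matching $M$ of $H$ if ($u$ is unmatched in $M$ or $v\succ_u M(u)$) and ($v$ is unmatched in $M$ or $u\succ_v M(v)$); $M$ is stable in $H$ if no edge of $H$ is a blocking pair. In the restricted instance on $G[U'\cup V]$ (the subgraph induced by $U'\cup V$), each vertex's preference is the restriction of its original order to its neighbors in that subgraph. Stable matchings always exist and all stable matchings of an instance match the same vertex set, so $F(U')$ is well defined (e.g., it is the set of $V$-vertices matched by the output of the $U$-proposing deferred acceptance algorithm on the restricted instance). A set system $(V,\mathcal{F})$ with $\mathcal{F}\subseteq 2^V$ is an antimatroid if $\mathcal{F}\neq\emptyset$, every nonempty $X\in\mathcal{F}$ has an element $e\in X$ with $X\setminus\{e\}\in\mathcal{F}$ (accessibility), and $X,Y\in\mathcal{F}$ implies $X\cup Y\in\mathcal{F}$ (union-closedness). *)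

(* Defs.v *)
From HB Require Import structures.
From mathcomp Require Import all_boot.

Set Implicit Arguments.
Unset Strict Implicit.
Unset Printing Implicit Defensive.

(* A bipartite graph (U, V; E) with preferences: prefU G u v w reads "v >_u w",
   prefV G v u w reads "u >_v w". Only the values of prefU G u (resp. prefV G v)
   on neighbours of u (resp. v) are meaningful. *)
Record instance (U V : finType) := Instance {
  edges : {set U * V};
  prefU : U -> rel V;
  prefV : V -> rel U
}.

Definition strict_total_order_on (T : finType) (A : {set T}) (r : rel T) : Prop :=
  [/\ {in A, irreflexive r},
      {in A & &, transitive r}
    & {in A &, forall x y, x != y -> r x y || r y x}].

Section StableMatchings.
Variables U V : finType.
Implicit Types (G : instance U V) (M : {set U * V}) (S : {set U}).

Definition nbrU G (u : U) : {set V} := [set v | (u, v) \in edges G].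
Definition nbrV G (v : V) : {set U} := [set u | (u, v) \in edges G].

Definition strict_preferences G : Prop :=
  (forall u, strict_total_order_on (nbrU G u) (prefU G u)) /\
  (forall v, strict_total_order_on (nbrV G v) (prefV G v)).

Definition restrict_rel (T : finType) (A : {set T}) (r : rel T) : rel T :=
  [rel x y | [&& x \in A, y \in A & r x y]].

Definition induced_edges G S : {set U * V} := [set e in edges G | e.1 \in S].

(* The restricted instance on G[S :|: V]. The vertices of U outside S are kept
   in the type, but as isolated vertices: they belong to no edge, hence to no
   matching and no blocking pair. *)
Definition restrict G S : instance U V := {|
  edges := induced_edges G S;
  prefU := fun u =>
    restrict_rel [set v | (u, v) \in induced_edges G S] (prefU G u);
  prefV := fun v =>
    restrict_rel [set u | (u, v) \in induced_edges G S] (prefV G v)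
|}.

Definition matching G M : bool :=
  (M \subset edges G) &&
  [forall e in M, forall f in M, (e.1 == f.1) || (e.2 == f.2) ==> (e == f)].

(* M(u) and M(v); None means unmatched. *)
Definition partnerU M (u : U) : option V := [pick v | (u, v) \in M].
Definition partnerV M (v : V) : option U := [pick u | (u, v) \in M].

Definition prefers (T : Type) (r : rel T) (x : T) (current : option T) : bool :=
  if current is Some y then r x y else true.

Definition blocking_pair G M (u : U) (v : V) : bool :=
  [&& (u, v) \in edges G,
      prefers (prefU G u) v (partnerU M u)
    & prefers (prefV G v) u (partnerV M v)].

Definition stable_matching G M : bool :=
  matching G M && [forall u, forall v, ~~ blocking_pair G M u v].

Definition matchedV M : {set V} := [set v | partnerV M v != None].

(* F(S): the V-vertices covered by a stable matching of G[S :|: V]. A stable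
   matching always exists (so the default set0 is never used) and all of them
   cover the same vertices (so the matching picked is irrelevant). *)
Definition F G S : {set V} :=
  if [pick M | stable_matching (restrict G S) M] is Some M
  then matchedV M else set0.

Definition matched_family G : {set {set V}} := [set F G S | S : {set U}].

End StableMatchings.

Definition antimatroid (T : finType) (FF : {set {set T}}) : Prop :=
  [/\ FF != set0,
      forall X, X \in FF -> X != set0 -> exists2 e, e \in X & X :\ e \in FF
    & forall X Y, X \in FF -> Y \in FF -> X :|: Y \in FF].

(* Main.v *)
Require Import Defs.
From mathcomp Require Import all_boot.

Set Implicit Arguments.
Unset Strict Implicit.
Unset Printing Implicit Defensive.

(** The family consists of the V-covers of the matchings that are stable in the
    subgraph induced by V and their own U-support.  Both antimatroid axioms
    follow from an exchange property: if X and Y are such covers and Y is not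
    contained in X, then X + z is one for some z in Y \ X.  To prove it, choose
    the matching M covering X that is best for V.  If t is outside the support
    of M and some v in X prefers t to its partner, then t must have a neighbour
    outside X that it likes better than v: otherwise giving the favourite such v
    to t would improve M.  Following the alternating path of M and of a matching
    N of cover Y from a vertex of Y \ X, one reaches a t in the support of N but
    not in that of M whose favourite neighbour z outside X lies in Y, and
    M + (t, z) is stable. *)

(** * Strict total orders on a finite set *)

Section StrictOrders.
Variables (T : finType) (A : {set T}) (r : rel T).
Hypothesis rA : strict_total_order_on A r.

Lemma strict_total_order_asym x y : x \in A -> y \in A -> r x y -> ~~ r y x.
Proof.
case: rA => irr tr _ Ax Ay rxy; apply/negP => ryx.
by have := tr y x x Ay Ax Ax rxy ryx; rewrite irr.
Qed.

Lemma strict_total_order_negb x y : x \in A -> y \in A ->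
  ~~ r x y -> (y == x) || r y x.
Proof.
case: rA => _ _ tot Ax Ay nrxy; case: (eqVneq y x) => //= ne.
by have := tot y x Ay Ax ne; rewrite (negPf nrxy) orbF.
Qed.

(** Counts the elements of [B] that [x] beats, so larger is better. It turns an order into a number,
    used both to find favourites and to measure the quality of a matching. *)
Definition rank_in (B : {set T}) x := #|[set y in B | r x y]|.

Lemma rank_in_lt (B : {set T}) x y : B \subset A -> x \in B -> y \in B ->
  r y x -> rank_in B x < rank_in B y.
Proof.
case: rA => irr tr _ /subsetP sBA Bx By ryx; apply: proper_card.
apply/properP; split; last first.
  by exists x; rewrite inE Bx ?ryx // irr ?sBA.
apply/subsetP => z; rewrite !inE => /andP[Bz rxz]; rewrite Bz /=.
by apply: (tr x y z) => //; apply: sBA.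
Qed.

Lemma exists_favourite (B : {set T}) x : B \subset A -> x \in B ->
  exists2 m, m \in B & {in B, forall y, (m == y) || r m y}.
Proof.
move=> sBA Bx; case: (arg_maxnP (rank_in B) Bx) => m /= Bm max_m.
exists m => // y By; have [Am Ay] := (subsetP sBA m Bm, subsetP sBA y By).
apply: strict_total_order_negb => //; apply/negP => rym.
by have := rank_in_lt sBA Bm By rym; rewrite ltnNge max_m.
Qed.

End StrictOrders.

(* A finite form of the alternating path argument, by counting edges. *)
Lemma alternating_cover (U V : finType) (D C : {set U * V}) :
    {in D &, injective fst} -> {in C &, injective snd} ->
    fst @: D \subset fst @: C -> snd @: C \subset snd @: D ->
  snd @: D \subset snd @: C.
Proof.
move=> injD injC sDC sCD.
suff /eqP <- : snd @: C == snd @: D by [].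
rewrite eqEcard sCD /= (card_in_imset injC).
apply: leq_trans (leq_imset_card _ _) _.
by rewrite -(card_in_imset injD) (leq_trans (subset_leq_card sDC)) ?leq_imset_card.
Qed.

(** * Stability in restricted instances, and covers of stable matchings *)

Section Stability.
Variables (U V : finType) (G : instance U V).
Hypothesis prefG : strict_preferences G.
Implicit Types (M N : {set U * V}) (S : {set U}) (X Y : {set V}).

Let prefUP u : strict_total_order_on (nbrU G u) (prefU G u).
Proof. by case: prefG. Qed.

Let prefVP v : strict_total_order_on (nbrV G v) (prefV G v).
Proof. by case: prefG. Qed.

Definition contentU M u v :=
  exists2 w, (u, w) \in M & (w == v) || prefU G u w v.

Definition contentV M u v :=
  exists2 w, (w, v) \in M & (w == u) || prefV G v w u.

(** Stability in positive form: every edge leaving [S] has an end holding a partner at least as good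
    as the other end. Matchings appear as injectivity of both projections, ready for counting. *)
Definition stable_on S M : Prop :=
  [/\ M \subset induced_edges G S,
      {in M &, injective fst}, {in M &, injective snd}
    & forall u v, u \in S -> (u, v) \in edges G ->
        contentU M u v \/ contentV M u v].

Lemma mem_imset_fst M u v : (u, v) \in M -> u \in fst @: M.
Proof. by move=> Muv; apply/imsetP; exists (u, v). Qed.

Lemma mem_imset_snd M u v : (u, v) \in M -> v \in snd @: M.
Proof. by move=> Muv; apply/imsetP; exists (u, v). Qed.

Lemma imset_sndP M v : v \in snd @: M -> exists u, (u, v) \in M.
Proof. by case/imsetP => [[u w] Muw ->]; exists u. Qed.

Lemma imset_fstP M u : u \in fst @: M -> exists v, (u, v) \in M.
Proof. by case/imsetP => [[w v] Mwv ->]; exists v. Qed.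

Lemma matchedV_imset M : matchedV M = snd @: M.
Proof.
apply/setP => v; rewrite inE /partnerV; case: pickP => [u Muv|no] /=.
  by rewrite (mem_imset_snd Muv).
by apply/esym/negP => /imset_sndP[u]; rewrite no.
Qed.

Lemma matchingP H M : reflect
  [/\ M \subset edges H, {in M &, injective fst} & {in M &, injective snd}]
  (matching H M).
Proof.
apply: (iffP andP) => [[sME /forall_inP inj] | [sME inj1 inj2]].
  split=> // e f Me Mf ef; have /forall_inP/(_ f Mf) := inj e Me;
  by rewrite ef eqxx ?orbT => /eqP.
split=> //; apply/forall_inP => e Me; apply/forall_inP => f Mf.
apply/implyP => /orP[] /eqP ef; apply/eqP; [exact: inj1 | exact: inj2].
Qed.

Lemma stable_on_set0 : stable_on (fst @: (set0 : {set U * V})) set0.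
Proof.
by split=> [|e f|e f|u v]; rewrite ?sub0set ?imset0 ?inE.
Qed.

Section StableOn.
Variables (S : {set U}) (M : {set U * V}).
Hypothesis stM : stable_on S M.

Lemma stable_on_edge u v : (u, v) \in M -> (u, v) \in edges G.
Proof.
by case: stM => /subsetP sM _ _ _ /sM; rewrite inE => /andP[].
Qed.

Lemma stable_on_support u v : (u, v) \in M -> u \in S.
Proof.
by case: stM => /subsetP sM _ _ _ /sM; rewrite inE => /andP[].
Qed.

Lemma stable_on_uniqU u v w : (u, v) \in M -> (u, w) \in M -> v = w.
Proof. by case: stM => _ inj _ _ Mv Mw; case: (inj _ _ Mv Mw erefl). Qed.

Lemma stable_on_uniqV u w v : (u, v) \in M -> (w, v) \in M -> u = w.
Proof. by case: stM => _ _ inj _ Mv Mw; case: (inj _ _ Mv Mw erefl). Qed.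

Lemma stable_on_content u v : u \in S -> (u, v) \in edges G ->
  contentU M u v \/ contentV M u v.
Proof. by case: stM => _ _ _; apply. Qed.

(** Shrinking [S] to the matched vertices only drops edges to be checked. Hence a matching can stand
    for its own restricted instance. *)
Lemma stable_on_self : stable_on (fst @: M) M.
Proof.
have [sM inj1 inj2 st] := stM; split=> //.
  apply/subsetP => -[u v] Muv.
  by rewrite inE (stable_on_edge Muv) (mem_imset_fst Muv).
by move=> u v /imset_fstP[w /stable_on_support]; apply: st.
Qed.

End StableOn.

(** Totality turns a failed strict preference into a weak one in the other direction; asymmetry and
    irreflexivity give the converse. *)
Lemma stable_matchingP S M :
  reflect (stable_on S M) (stable_matching (restrict G S) M).
Proof.
apply: (iffP andP) => [[/matchingP[sM inj1 inj2] /forallP st] | stM].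
  split=> // u v Su Euv; have /forallP/(_ v) := st u.
  have Ruv : (u, v) \in induced_edges G S by rewrite inE Euv.
  have edgeM x y : (x, y) \in M -> ((x, y) \in induced_edges G S) * ((x, y) \in edges G).
    by move=> /(subsetP sM) R; rewrite R; move: R; rewrite inE => /andP[->].
  rewrite /blocking_pair /= Ruv /= negb_and => /orP[].
    rewrite /partnerU; case: pickP => //= w Muw.
    rewrite /restrict_rel /= !inE /= Su Euv (edgeM _ _ Muw).2 /= => nr; left; exists w => //.
    by apply: (strict_total_order_negb (prefUP u)); rewrite ?inE ?(edgeM _ _ Muw).2.
  rewrite /partnerV; case: pickP => //= w Mwv.
  rewrite /restrict_rel /= !inE /= Su Euv (edgeM _ _ Mwv).2 /=.
  have := (edgeM _ _ Mwv).1; rewrite inE => /andP[_ /= ->] /= nr.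
  right; exists w => //.
  by apply: (strict_total_order_negb (prefVP v)); rewrite ?inE ?(edgeM _ _ Mwv).2.
have [sM inj1 inj2 st] := stM; split; first by apply/matchingP.
apply/forallP => u; apply/forallP => v; rewrite /blocking_pair /=.
apply/negP => /and3P[]; rewrite inE => /andP[Euv /= Su] bU bV.
have [irrU _ _] := prefUP u; have [irrV _ _] := prefVP v.
case: (st u v Su Euv) => [] [w Mw].
  move: bU; rewrite /partnerU; case: pickP => [w' /= Mw'|/(_ w)]; last by rewrite Mw.
  rewrite -(stable_on_uniqU stM Mw Mw') => /and3P[_ _ rvw].
  have Ew := stable_on_edge stM Mw.
  case/orP => [/eqP wv | rwv]; first by move: rvw; rewrite wv irrU // inE.
  by have := strict_total_order_asym (prefUP u) _ _ rvw;
  rewrite rwv !inE Euv Ew => /(_ erefl erefl).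
move: bV; rewrite /partnerV; case: pickP => [w' /= Mw'|/(_ w)]; last by rewrite Mw.
rewrite -(stable_on_uniqV stM Mw Mw') => /and3P[_ _ ruw].
have Ew := stable_on_edge stM Mw.
case/orP => [/eqP wv | rwv]; first by move: ruw; rewrite wv irrV // inE.
by have := strict_total_order_asym (prefVP v) _ _ ruw;
  rewrite rwv !inE Euv Ew => /(_ erefl erefl).
Qed.

(* The hypothesis provides the odd steps of an alternating path; its even steps
   come from the stability of N. *)
Lemma cover_subset S T M N : stable_on S M -> stable_on T N ->
    (forall u v, (u, v) \in N -> ~ contentV M u v ->
       exists2 w, (u, w) \in M & prefU G u w v) ->
  snd @: N \subset snd @: M.
Proof.
move=> stM stN oddstep.
pose wantV (e : U * V) :=
  [forall w, ((w, e.2) \in M) ==> ~~ ((w == e.1) || prefV G e.2 w e.1)].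
have wantVP u v : reflect (~ contentV M u v) (wantV (u, v)).
  apply: (iffP forallP) => [h [w Mw c] | h w].
    by have := h w; rewrite Mw /= c.
  by apply/implyP => Mw; apply/negP => c; apply: h; exists w.
(* [D] collects the edges of [N] whose V-end is unmatched in [M] or prefers its [N]-partner; [C]
   collects the edges of [M] whose U-end is matched in [N] and prefers its [M]-partner. The
   hypothesis leads from [D] to [C] through U, and stability of [N] leads back through V. *)
pose D := [set e in N | wantV e].
pose C := [set e in M | [exists v, ((e.1, v) \in N) && prefU G e.1 e.2 v]].
have sDC : fst @: D \subset fst @: C.
  apply/subsetP => u /imset_fstP[v]; rewrite inE => /andP[Nuv /wantVP nc].
  have [w Mw rwv] := oddstep u v Nuv nc.
  apply: (@mem_imset_fst _ _ w); rewrite inE Mw /=.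
  by apply/existsP; exists v; rewrite Nuv.
have sCD : snd @: C \subset snd @: D.
  apply/subsetP => w /imset_sndP[u]; rewrite inE => /andP[Muw /existsP[v /andP[/= Nuv rwv]]].
  have [Ew Ev] := (stable_on_edge stM Muw, stable_on_edge stN Nuv).
  have [irrU _ _] := prefUP u; have [irrV _ _] := prefVP w.
  case: (stable_on_content stN (stable_on_support stN Nuv) Ew) => [] [x Nx].
    rewrite -(stable_on_uniqU stN Nuv Nx) => /orP[/eqP vw|rvw].
      by move: rwv; rewrite vw irrU // inE.
    by have := strict_total_order_asym (prefUP u) _ _ rwv;
    rewrite rvw !inE Ew Ev => /(_ erefl erefl).
  have Ex := stable_on_edge stN Nx.
  case/orP => [/eqP xu|rxu].
    move: Nx; rewrite xu => Nuw; move: rwv.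
    by rewrite -(stable_on_uniqU stN Nuw Nuv) irrU // inE.
  apply: (@mem_imset_snd _ x); rewrite inE Nx /=; apply/wantVP => -[y My].
  rewrite -(stable_on_uniqV stM Muw My) => /orP[/eqP ux|rux].
    by move: rxu; rewrite ux irrV // inE.
  by have := strict_total_order_asym (prefVP w) _ _ rxu;
  rewrite rux !inE Ew Ex => /(_ erefl erefl).
have injD : {in D &, injective fst}.
  move=> e f; rewrite !inE => /andP[Ne _] /andP[Nf _].
  by case: stN => _ inj _ _; apply: inj.
have injC : {in C &, injective snd}.
  move=> e f; rewrite !inE => /andP[Me _] /andP[Mf _].
  by case: stM => _ _ inj _; apply: inj.
have sub := alternating_cover injD injC sDC sCD.
apply/subsetP => v /imset_sndP[u Nuv]; apply/negPn/negP => nMv.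
(* A vertex missed by [M] satisfies the condition in [D] vacuously. *)
have /(subsetP sub)/imset_sndP[w] : v \in snd @: D.
  apply: (@mem_imset_snd _ u); rewrite inE Nuv /=.
  by apply/wantVP => -[w /mem_imset_snd Mv]; rewrite Mv in nMv.
by rewrite inE => /andP[/mem_imset_snd Mv _]; rewrite Mv in nMv.
Qed.

Lemma contentU_strict M u v : ~ contentV M u v -> contentU M u v ->
  exists2 w, (u, w) \in M & prefU G u w v.
Proof.
move=> nc [w Mw /orP[/eqP wv|]]; last by exists w.
by case: nc; exists u; rewrite ?eqxx // -wv.
Qed.

(** With a common [S], stability of [M] applies to the edges of [N] and supplies the odd steps. Used
    in both directions, it shows that the choice made in [F] does not affect the cover. *)
Lemma stable_on_cover S M N : stable_on S M -> stable_on S N ->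
  snd @: N \subset snd @: M.
Proof.
move=> stM stN; apply: (cover_subset stM stN) => u v Nuv nc.
have Su := stable_on_support stN Nuv.
case: (stable_on_content stM Su (stable_on_edge stN Nuv)) => // c.
exact: contentU_strict nc c.
Qed.

Lemma matched_familyP X : reflect
  (exists2 M : {set U * V}, stable_on (fst @: M) M & X = snd @: M)
  (X \in matched_family G).
Proof.
apply: (iffP imsetP) => [[S _ ->] | [M stM ->]].
  rewrite /F; case: pickP => [M /stable_matchingP stM | _].
    by exists M; [exact: stable_on_self stM | exact: matchedV_imset].
  (* The default value of [F] is the cover of the empty matching. *)
  by exists set0; [exact: stable_on_set0 | rewrite imset0].
exists (fst @: M) => //; rewrite /F; case: pickP => [N /stable_matchingP stN|].
  by apply/eqP; rewrite matchedV_imset eqEsubset !(stable_on_cover (S := fst @: M)).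
by move/(_ M); move/stable_matchingP: stM => ->.
Qed.

(** * Matchings that are best for V among those with a given cover *)

Definition saturated M := forall t v u, t \notin fst @: M ->
  (t, v) \in edges G -> (u, v) \in M -> prefV G v t u ->
  exists2 z, z \notin snd @: M & ((t, z) \in edges G) && prefU G t z v.

Definition welfare M := \sum_(e in M) rank_in (prefV G e.2) (nbrV G e.2) e.1.

(** Among the covered vertices that would leave their partner for [t], give [t] its favourite [m].
    The old partner [s] of [m] leaves the support, so its edges impose nothing any more; on the V
    side only [m] changes partner, for a better one. *)
Lemma improve_swap M t v u : stable_on (fst @: M) M ->
    t \notin fst @: M -> (t, v) \in edges G -> (u, v) \in M -> prefV G v t u ->
    (forall z, z \notin snd @: M -> (t, z) \in edges G -> ~~ prefU G t z v) ->
  exists M' : {set U * V}, [/\ stable_on (fst @: M') M', snd @: M' = snd @: M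
               & welfare M < welfare M'].
Proof.
move=> stM nt Etv Muv rtu nout.
pose B := [set w | ((t, w) \in edges G) && [exists x, ((x, w) \in M) && prefV G w t x]].
have Bv : v \in B by rewrite inE Etv; apply/existsP; exists u; rewrite Muv.
have sB : B \subset nbrU G t by apply/subsetP => w; rewrite !inE => /andP[].
have [m Bm max_m] := exists_favourite (prefUP t) sB Bv.
move: (Bm); rewrite inE => /andP[Etm /existsP[s /andP[Msm rts]]].
have Esm := stable_on_edge stM Msm.
have [irrU trU _] := prefUP t; have [irrm trm _] := prefVP m.
have noutm z : z \notin snd @: M -> (t, z) \in edges G -> ~~ prefU G t z m.
  move=> nz Etz; apply/negP => rzm; have := nout z nz Etz.
  case/orP: (max_m v Bv) => [/eqP <-|rmv]; first by rewrite rzm.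
  by rewrite (trU m z v) // inE.
have ntM w : (t, w) \notin M by apply: contra nt => /mem_imset_fst.
have inM' x w : ((x, w) \in (t, m) |: (M :\ (s, m))) =
    ((x == t) && (w == m)) || [&& (x, w) \in M & w != m].
  rewrite !inE !xpair_eqE; case: (eqVneq w m) => [->|_]; last first.
    by rewrite !andbF /= andbT.
  rewrite !andbT /= andbF; congr (_ || _); apply/negP => /andP[/eqP xs Mxm].
  by case: xs; exact: (stable_on_uniqV stM Mxm Msm).
exists ((t, m) |: (M :\ (s, m))); split.
- split.
  + apply/subsetP => -[x w] M'xw; rewrite inE (mem_imset_fst M'xw) andbT.
    by move: M'xw; rewrite inM' => /orP[/andP[/eqP-> /eqP->]|/andP[/(stable_on_edge stM)]].
  + move=> [x w] [y z] Mx My /= xy; rewrite -{y}xy in My *; move: Mx My.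
    rewrite !inM' => /orP[/andP[/eqP-> /eqP->]|/andP[Mx _]].
      by rewrite eqxx (negPf (ntM z)) /= orbF => /eqP->.
    case/orP => [/andP[/eqP xt]|/andP[My _]]; first by rewrite xt (negPf (ntM w)) in Mx.
    by rewrite (stable_on_uniqU stM Mx My).
  + move=> [x w] [y z] Mx My /= xy; rewrite -{z}xy in My *; move: Mx My.
    rewrite !inM' => /orP[/andP[/eqP-> /eqP->]|/andP[Mx nw]].
      by rewrite eqxx andbF orbF andbT => /eqP->.
    rewrite (negPf nw) andbF /= => /andP[My _].
    by rewrite (stable_on_uniqV stM Mx My).
  + move=> x w /imset_fstP[y]; rewrite inM' => /orP[/andP[/eqP-> _]|/andP[Mxy ny]] Exw.
      case: (boolP ((w == m) || prefU G t m w)) => [c|/norP[nwm nr]].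
        by left; exists m; rewrite ?inM' ?eqxx // eq_sym.
      (* Here [t] prefers [w] to [m]. So [w] is covered by [noutm], and it does not prefer [t] to
         its partner, as [m] is the favourite in [B]. *)
      right.
      have rwm : prefU G t w m.
        have := strict_total_order_negb (prefUP t) _ _ nr.
        by rewrite !inE Etm Exw (negPf nwm) => /(_ erefl erefl).
      have /imset_sndP[a Ma] : w \in snd @: M.
        by apply/negPn/negP => nw; have := noutm w nw Exw; rewrite rwm.
      exists a; first by rewrite inM' Ma nwm orbT.
      apply: (strict_total_order_negb (prefVP w)); rewrite ?inE ?(stable_on_edge stM Ma) //.
      apply/negP => rta; have Bw : w \in B.
        by rewrite inE Exw; apply/existsP; exists a; rewrite Ma.
      case/orP: (max_m w Bw) => [/eqP mw|]; first by rewrite mw eqxx in nwm.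
      by rewrite (negPf nr).
    case: (stable_on_content stM (mem_imset_fst Mxy) Exw) => [] [z Mz c].
      left; exists z => //; rewrite inM' Mz /=.
      by rewrite -(stable_on_uniqU stM Mxy Mz) ny orbT.
    right; case: (eqVneq w m) => [wm|nwm]; last first.
      by exists z => //; rewrite inM' Mz nwm orbT.
    (* The old partner [s] was at least as good as [x] for [m], and [t] is better than [s]. *)
    exists t; first by rewrite inM' wm !eqxx.
    rewrite wm in Mz c Exw *; rewrite (stable_on_uniqV stM Mz Msm) in c.
    case/orP: c => [/eqP<-|rsx]; first by rewrite rts orbT.
    by rewrite (trm s t x) ?orbT // inE.
- apply/setP => w; apply/idP/idP => /imset_sndP[x].
    rewrite inM' => /orP[/andP[_ /eqP->]|/andP[Mx _]]; first exact: mem_imset_snd Msm.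
    exact: mem_imset_snd Mx.
  move=> Mx; case: (eqVneq w m) => [->|nw].
    by apply: (@mem_imset_snd _ t); rewrite inM' !eqxx.
  by apply: (@mem_imset_snd _ x); rewrite inM' Mx nw orbT.
- rewrite /welfare big_setU1 /= ?inE ?xpair_eqE ?(negPf (ntM m)) ?andbF //.
  rewrite (big_setD1 _ Msm) /= ltn_add2r.
  by apply: (rank_in_lt (prefVP m)); rewrite ?inE.
Qed.

Lemma exists_saturated M : stable_on (fst @: M) M ->
  exists M' : {set U * V}, [/\ stable_on (fst @: M') M', snd @: M' = snd @: M & saturated M'].
Proof.
move=> stM; pose P (M' : {set U * V}) :=
  stable_matching (restrict G (fst @: M')) M' && (snd @: M' == snd @: M).
have PM : P M by rewrite /P eqxx andbT; apply/stable_matchingP.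
case: (arg_maxnP welfare PM) => N /andP[/stable_matchingP stN /eqP eqNM] maxN.
exists N; split=> // t v u nt Etv Nuv rtu.
case: (boolP [exists z, [&& z \notin snd @: N, (t, z) \in edges G & prefU G t z v]]).
  by case/existsP => z /andP[nz h]; exists z.
rewrite negb_exists => /forallP no.
have [|N' [stN' eqN' lt]] := improve_swap stN nt Etv Nuv rtu.
  by move=> z nz Etz; have := no z; rewrite nz Etz.
have : P N' by rewrite /P eqN' eqNM eqxx andbT; apply/stable_matchingP.
by move/maxN; rewrite /= leqNgt lt.
Qed.

(** Only edges at [t] are new constraints. If [t] and a covered [w] preferred each other to their
    partners, saturation would give an uncovered neighbour that [t] prefers to [w], hence to its
    favourite uncovered neighbour [z]. *)
Lemma add_edge M t z : stable_on (fst @: M) M -> saturated M ->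
    t \notin fst @: M -> z \notin snd @: M -> (t, z) \in edges G ->
    (forall y, y \notin snd @: M -> (t, y) \in edges G -> (z == y) || prefU G t z y) ->
  stable_on (fst @: ((t, z) |: M)) ((t, z) |: M).
Proof.
move=> stM satM nt nz Etz max_z.
have ntM w : (t, w) \notin M by apply: contra nt => /mem_imset_fst.
have nzM x : (x, z) \notin M by apply: contra nz => /mem_imset_snd.
have inM' x w : ((x, w) \in (t, z) |: M) = ((x == t) && (w == z)) || ((x, w) \in M).
  by rewrite !inE xpair_eqE.
have [irrU trU _] := prefUP t.
split.
- apply/subsetP => -[x w] M'xw; rewrite inE (mem_imset_fst M'xw) andbT.
  by move: M'xw; rewrite inM' => /orP[/andP[/eqP-> /eqP->]|/(stable_on_edge stM)].
- move=> [x w] [y v] Mx My /= xy; rewrite -{y}xy in My *; move: Mx My.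
  rewrite !inM' => /orP[/andP[/eqP-> /eqP->]|Mx].
    by rewrite eqxx (negPf (ntM v)) /= orbF => /eqP->.
  case/orP => [/andP[/eqP xt]|My]; first by rewrite xt (negPf (ntM w)) in Mx.
  by rewrite (stable_on_uniqU stM Mx My).
- move=> [x w] [y v] Mx My /= xy; rewrite -{v}xy in My *; move: Mx My.
  rewrite !inM' => /orP[/andP[/eqP-> /eqP->]|Mx].
    by rewrite eqxx (negPf (nzM y)) orbF andbT => /eqP->.
  case/orP => [/andP[_ /eqP wz]|My]; first by rewrite wz (negPf (nzM x)) in Mx.
  by rewrite (stable_on_uniqV stM Mx My).
- move=> x w /imset_fstP[y]; rewrite inM' => /orP[/andP[/eqP-> _]|Mxy] Exw; last first.
    case: (stable_on_content stM (mem_imset_fst Mxy) Exw) => [] [v Mv c];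
    by [left; exists v; rewrite ?inM' ?Mv ?orbT | right; exists v; rewrite ?inM' ?Mv ?orbT].
  case: (boolP ((z == w) || prefU G t z w)) => [c|/norP[nzw nr]].
    by left; exists z; rewrite ?inM' ?eqxx.
  have /imset_sndP[v Mv] : w \in snd @: M.
    by apply/negPn/negP => nw; have := max_z w nw Exw; rewrite (negPf nzw) (negPf nr).
  right; exists v; first by rewrite inM' Mv orbT.
  apply: (strict_total_order_negb (prefVP w)); rewrite ?inE ?(stable_on_edge stM Mv) //.
  apply/negP => rtv; have [a na /andP[Eta raw]] := satM t w v nt Exw Mv rtv.
  case/orP: (max_z a na Eta) => [/eqP za|rza]; first by rewrite za raw in nr.
  by rewrite (trU a z w) ?inE in nr.
Qed.

(** * The exchange property of the matched family *)

Lemma exchange X Y : X \in matched_family G -> Y \in matched_family G ->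
  ~~ (Y \subset X) -> exists2 z, z \in Y :\: X & z |: X \in matched_family G.
Proof.
move=> /matched_familyP[M0 st0 ->] /matched_familyP[N stN ->].
have [M [stM <- satM] {M0 st0}] := exists_saturated st0.
move=> nsub; set X0 := snd @: M; set Y0 := snd @: N.
case: (boolP [exists z, (z \in Y0 :\: X0) && (z |: X0 \in matched_family G)]).
  by case/existsP => z /andP[]; exists z.
rewrite negb_exists => /forallP no; case/negP: nsub.
apply: (cover_subset stM stN) => u v Nuv nc.
have Euv := stable_on_edge stN Nuv; have Nu := mem_imset_fst Nuv.
case: (boolP (u \in fst @: M)) => [Mu | nMu].
  case: (stable_on_content stM Mu Euv) => // c.
  exact: contentU_strict nc c.
(* For [u] outside the support of [M] the odd step is replaced by a contradiction: the favourite of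
   [u] in [B] yields an exchange, which [no] excludes. *)
pose B := [set z | ((u, z) \in edges G) && (z \notin X0)].
have [irrU trU _] := prefUP u.
have [z0 Bz0 c0] : exists2 z, z \in B & (z == v) || prefU G u z v.
  case: (boolP (v \in X0)) => [/imset_sndP[w Mwv]|nv]; last first.
    by exists v; rewrite ?eqxx // inE Euv.
  have Ewv := stable_on_edge stM Mwv.
  have [|z nz /andP[Euz rzv]] := satM u v w nMu Euv Mwv.
    apply/negPn/negP => nr; apply: nc; exists w => //.
    by apply: (strict_total_order_negb (prefVP v)); rewrite ?inE.
  by exists z; rewrite ?inE ?Euz // rzv orbT.
have sB : B \subset nbrU G u by apply/subsetP => w; rewrite !inE => /andP[].
have [z Bz max_z] := exists_favourite (prefUP u) sB Bz0.
move: (Bz) (Bz0); rewrite !inE => /andP[Euz nz] /andP[Euz0 _].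
have c : (z == v) || prefU G u z v.
  case/orP: (max_z z0 Bz0) => [/eqP->//|rz]; case/orP: c0 => [/eqP<-|r0].
    by rewrite rz orbT.
  by rewrite (trU z0 z v) ?orbT // inE.
(* Since [u] likes [z] at least as much as its [N]-partner [v], stability of [N] at the edge from
   [u] to [z] forces [N] to cover [z]. *)
have Yz : z \in Y0.
  case/orP: c => [/eqP->|rzv]; first exact: mem_imset_snd Nuv.
  case: (stable_on_content stN Nu Euz) => [] [w Nw]; last by move=> _; exact: mem_imset_snd Nw.
  rewrite -(stable_on_uniqU stN Nuv Nw) => /orP[/eqP<-|rvz]; first exact: mem_imset_snd Nuv.
  by have := strict_total_order_asym (prefUP u) _ _ rzv;
  rewrite rvz !inE Euz Euv => /(_ erefl erefl).
have := no z; rewrite !inE Yz nz /= => /matched_familyP[].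
exists ((u, z) |: M); last by rewrite imsetU1.
by apply: add_edge => // y ny Euy; apply: max_z; rewrite inE Euy.
Qed.

Lemma matched_family0 : set0 \in matched_family G.
Proof.
by apply/matched_familyP; exists set0; [exact: stable_on_set0 | rewrite imset0].
Qed.

End Stability.

(** * From the exchange property to the antimatroid axioms *)

Section Exchange.
Variables (T : finType) (FF : {set {set T}}).
Hypothesis FF0 : set0 \in FF.
Hypothesis exchFF : forall X Y, X \in FF -> Y \in FF -> ~~ (Y \subset X) ->
  exists2 z, z \in Y :\: X & z |: X \in FF.

(** Each exchange moves an element of [Y] into [X]: the union stays the same while the difference
    shrinks. *)
Lemma exchange_unionclosed X Y : X \in FF -> Y \in FF -> X :|: Y \in FF.
Proof.
move=> FX FY; have [n] := ubnP #|Y :\: X|; elim: n X FX => // n IHn X FX le_n.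
case: (boolP (Y \subset X)) => [/setUidPl->//|/(exchFF FX FY)[z]].
rewrite inE => /andP[nXz Yz] FzX.
have -> : X :|: Y = (z |: X) :|: Y.
  by apply/setP => x; rewrite !inE; case: eqP => // ->; rewrite Yz orbT.
apply: IHn => //; rewrite -ltnS; apply: leq_trans le_n; rewrite ltnS.
apply: proper_card; apply/properP; split; first by rewrite setDS ?subsetUr.
by exists z; rewrite !inE ?eqxx ?nXz.
Qed.

(** Exchange from an inclusion-maximal member [X] properly inside [Y]: the enlarged set lies in [Y],
    so by maximality it equals [Y], and [X] is [Y] minus one element. *)
Lemma exchange_accessible Y : Y \in FF -> Y != set0 ->
  exists2 e, e \in Y & Y :\ e \in FF.
Proof.
move=> FY nY.
pose P X := (X \in FF) && (X \proper Y).
have P0 : P set0 by rewrite /P FF0 proper0.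
have [X /maxsetP[/andP[FX XY] maxX] _] := maxset_exists P0.
have [|z] := exchFF FX FY; first by rewrite properE in XY; case/andP: XY.
rewrite inE => /andP[nXz Yz] FzX; exists z => //.
suff -> : Y :\ z = X by [].
have sX : z |: X \subset Y by rewrite subUset sub1set Yz (proper_sub XY).
have : ~~ (z |: X \proper Y).
  apply/negP => pr; move: nXz; rewrite -(maxX (z |: X)) /P ?FzX ?subsetUr //.
  by rewrite !inE eqxx.
by rewrite properEneq sX andbT negbK => /eqP<-; rewrite setU1K.
Qed.

End Exchange.

Theorem theorem1 (U V : finType) (G : instance U V) :
  strict_preferences G -> antimatroid (matched_family G).
Proof.
move=> prefG; have F0 := matched_family0 prefG; have exch := exchange prefG.
split; first by apply/set0Pn; exists set0.
- exact: exchange_accessible.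
- exact: exchange_unionclosed.
Qed.
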